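(* Consider a stochastic $K$-armed bandit with independent rewards supported in $[0,1]$, a partition of the horizon $T$ into $B$ blocks with lengths $(H_b)$ and integer floor vectors $(m_{b,i})$, and a failure probability $\eta\in(0,1)$. Let $L=\log(2KT/\eta)$ and let $R=\sum_{b=1}^B\bigl(H_b-\sum_{i=1}^K m_{b,i}\bigr)$. The algorithm BDQ-UCB satisfies: (i) Deterministically, $N_{b,i}\ge m_{b,i}$ for every block $b$ and arm $i$. (ii) With probability at least $1-\eta$, $$\widehat{\mathrm{Reg}}_{\mathbf m}(T)\le K+\sum_{i:\Delta_i>0}\min\Bigl\{R\Delta_i,\ \frac{8L}{\Delta_i}\Bigr\}.$$ (iii) With probability at least $1-\eta$, $$\widehat{\mathrm{Reg}}_{\mathbf m}(T)\le K+4\sqrt{2KRL}.$$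
   Context: Bandit: arm $i\in[K]$ produces independent rewards in $[0,1]$ with mean $\mu_i$ (i.i.d. within an arm); $\mu_\star=\max_i\mu_i$, $i^\star$ is an arm attaining the maximum, $\Delta_i=\mu_\star-\mu_i$; $A_t$ is the arm pulled at round $t$. Blockwise floors: the horizon $T=\sum_{b=1}^B H_b$ is partitioned into $B$ consecutive blocks, block $b$ of length $H_b$ with floor vector $m_b=(m_{b,1},\dots,m_{b,K})\in\mathbb Z_{\ge0}^K$, $\sum_i m_{b,i}\le H_b$. $N_{b,i}$ is the number of pulls of arm $i$ inside block $b$. The best blockwise-fair value is $\mathrm{OPT}_{\mathbf m}(T)=T\mu_\star-\sum_{b=1}^B\sum_{i\ne i^\star}m_{b,i}\Delta_i$, and the realized blockwise fair pseudo-regret is $\widehat{\mathrm{Reg}}_{\mathbf m}(T)=\mathrm{OPT}_{\mathbf m}(T)-\sum_{t=1}^T\mu_{A_t}$. BDQ-UCB: for $b=1,\dots,B$: first pull each arm $i$ exactly $m_{b,i}$ times (in any fixed order); then in each of the remaining $H_b-\sum_i m_{b,i}$ (residual) rounds of the block, set $U_i=+\infty$ if $N_i=0$ and $U_i=\widehat\mu_i+\sqrt{2L/N_i}$ otherwise, where $N_i$ is the total number of pulls of arm $i$ so far over all blocks (mandatory and residual) and $\widehat\mu_i$ the empirical mean of all its observed rewards, and pull an arm in $\arg\max_i U_i$. *)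

(* Defs.v *)
From HB Require Import structures.
From mathcomp Require Import all_boot all_order all_algebra.
From mathcomp Require Import all_classical all_reals all_analysis.
Set Implicit Arguments.
Unset Strict Implicit.
Unset Printing Implicit Defensive.
Import Order.TTheory GRing.Theory Num.Theory.
Import numFieldNormedType.Exports.
Local Open Scope classical_set_scope.
Local Open Scope ring_scope.

Definition mutually_independent (R : realType) (d : measure_display)
    (Omega : measurableType d) (P : probability Omega R) (I : eqType)
    (Y : I -> {RV P >-> R}) : Prop :=
  forall (s : seq I) (E : I -> set R), uniq s ->
    (forall i, measurable (E i)) ->
    P [set w | forall i, i \in s -> E i (Y i w)]
      = (\prod_(i <- s) P (Y i @^-1` E i))%E.

(* [X i n] is the reward returned by the [n.+1]-st pull of arm [i]. *)
Record stochastic_bandit (R : realType) (d : measure_display)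
    (Omega : measurableType d) (P : probability Omega R) (K : nat)
    (mu : 'I_K -> R) (X : 'I_K -> nat -> {RV P >-> R}) : Prop := {
  reward_support : forall i n, P (X i n @^-1` `[0, 1]) = 1%E ;
  reward_mean : forall i n, ('E_P[X i n] = (mu i)%:E)%E ;
  reward_id : forall i n n' (E : set R), measurable E ->
    distribution P (X i n) E = distribution P (X i n') E ;
  reward_indep : mutually_independent (fun p : 'I_K * nat => X p.1 p.2)
}.

Definition best_arm (R : realType) (K : nat) (mu : 'I_K -> R)
    (istar : 'I_K) : Prop := forall j, mu j <= mu istar.

Definition gap (R : realType) (K : nat) (mu : 'I_K -> R) (istar i : 'I_K) : R :=
  mu istar - mu i.

(* Rounds are numbered from 0: block [b] consists of the rounds [t] with
   [block_start H b <= t < block_start H b + H b]. *)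
Definition horizon (B : nat) (H : 'I_B -> nat) : nat := (\sum_(b < B) H b)%N.

Definition block_start (B : nat) (H : 'I_B -> nat) (b : 'I_B) : nat :=
  (\sum_(c < B | (c < b)%N) H c)%N.

Definition floor_total (B K : nat) (m : 'I_B -> 'I_K -> nat) (b : 'I_B) : nat :=
  (\sum_(i < K) m b i)%N.

(* The subtraction is exact when [floor_total m b <= H b]. *)
Definition residual (B K : nat) (H : 'I_B -> nat) (m : 'I_B -> 'I_K -> nat) :
  nat := (\sum_(b < B) (H b - floor_total m b))%N.

(* Number of rounds [u] with [s <= u < t] in which arm [i] is pulled. *)
Definition pulls (K : nat) (a : nat -> 'I_K) (i : 'I_K) (s t : nat) : nat :=
  (\sum_(s <= u < t) (a u == i))%N.

Definition block_pulls (B K : nat) (H : 'I_B -> nat) (a : nat -> 'I_K)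
    (b : 'I_B) (i : 'I_K) : nat :=
  pulls a i (block_start H b) (block_start H b + H b).

Definition observed_reward (R : realType) (K : nat) (x : 'I_K -> nat -> R)
    (a : nat -> 'I_K) (t : nat) : R := x (a t) (pulls a (a t) 0 t).

Definition empirical_mean (R : realType) (K : nat) (x : 'I_K -> nat -> R)
    (a : nat -> 'I_K) (i : 'I_K) (t : nat) : R :=
  (\sum_(0 <= u < t | a u == i) observed_reward x a u) / (pulls a i 0 t)%:R.

Definition ucb_index (R : realType) (K : nat) (L : R) (x : 'I_K -> nat -> R)
    (a : nat -> 'I_K) (i : 'I_K) (t : nat) : \bar R :=
  if pulls a i 0 t == 0%N then +oo%E
  else (empirical_mean x a i t + Num.sqrt (2 * L / (pulls a i 0 t)%:R))%:E.

(* [order b] lists the mandatory pulls of block [b] in the order in which they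
   are made. *)
Definition mandatory_order (B K : nat) (m : 'I_B -> 'I_K -> nat)
    (order : 'I_B -> seq 'I_K) : Prop :=
  forall b i, count_mem i (order b) = m b i.

(* The action sequence [a] is a run of BDQ-UCB on the reward table [x].  The
   argmax in a residual round is not unique in general: every way of breaking
   ties gives a run. *)
Record bdq_ucb_run (R : realType) (B K : nat) (H : 'I_B -> nat)
    (m : 'I_B -> 'I_K -> nat) (order : 'I_B -> seq 'I_K) (L : R)
    (x : 'I_K -> nat -> R) (a : nat -> 'I_K) : Prop := {
  run_mandatory : forall b : 'I_B,
    [seq a t | t <- iota (block_start H b) (floor_total m b)] = order b ;
  run_residual : forall (b : 'I_B) (t : nat),
    (block_start H b + floor_total m b <= t < block_start H b + H b)%N ->
    forall j : 'I_K, (ucb_index L x a j t <= ucb_index L x a (a t) t)%E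
}.

Definition opt_value (R : realType) (B K : nat) (H : 'I_B -> nat)
    (m : 'I_B -> 'I_K -> nat) (mu : 'I_K -> R) (istar : 'I_K) : R :=
  (horizon H)%:R * mu istar
  - \sum_(b < B) \sum_(i < K | i != istar) (m b i)%:R * gap mu istar i.

Definition fair_regret (R : realType) (B K : nat) (H : 'I_B -> nat)
    (m : 'I_B -> 'I_K -> nat) (mu : 'I_K -> R) (istar : 'I_K)
    (a : nat -> 'I_K) : R :=
  opt_value H m mu istar - \sum_(0 <= t < horizon H) mu (a t).

Definition log_factor (R : realType) (K T : nat) (eta : R) : R :=
  ln (2 * K%:R * T%:R / eta).

(* Main.v *)
(** On an event of probability at least [1 - eta], every empirical mean of [n]
    rewards, [1 <= n <= T], is within [sqrt (2 L / n)] of its mean.  On that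
    event an arm of gap [g] pulled in a residual round after [n >= 1] earlier
    pulls satisfies [g <= 2 sqrt (2 L / n)], since its index dominates the one
    of the best arm.  Mandatory pulls cancel against the fair optimum, so the
    regret is the sum of the gaps over residual rounds; applying the bound to
    the last residual pull of each arm gives (ii), and Cauchy-Schwarz over the
    arms gives (iii).  For the concentration, [exp (- x) <= 1 - x + x^2 / 2]
    shows that a centred [[0, 1]]-valued variable is 1-subgaussian, which is
    weaker than Hoeffding's lemma but leaves exactly [exp (- L)] per tail. *)

Require Import Defs.
From HB Require Import structures.
From mathcomp Require Import all_boot all_order all_algebra.
From mathcomp Require Import all_classical all_reals all_analysis.
From mathcomp Require Import measurable_realfun lra ring zify.
Import Order.TTheory GRing.Theory Num.Theory.
Import numFieldNormedType.Exports.
Local Open Scope classical_set_scope.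
Local Open Scope ring_scope.

Set Implicit Arguments.
Unset Strict Implicit.

(** * Expectation of a product of independent variables *)

Section IntegralComposition.
Import HBNNSimple.

(** Simple-function stage: [g] is a finite sum of its values times the indicators of its fibres,
    which reduces the integral to indicators. *)
Lemma integral_mul_nnsfun (R : realType) (d : measure_display)
    (T : measurableType d) (mu : {measure set T -> \bar R})
    (d' : measure_display) (T' : measurableType d') (W : T -> R) (phi : T -> T')
    (g : {nnsfun T' >-> R}) :
  measurable_fun setT W -> measurable_fun setT phi -> (forall w, 0 <= W w) ->
  (\int[mu]_w (W w * g (phi w))%:E =
   \sum_(y \in range g)
     (y%:E * \int[mu]_w (W w * \1_(g @^-1` [set y]) (phi w))%:E))%E.
Proof.
move=> mW mphi W0.
have mI (y : R) : measurable_fun setT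
    (fun w => W w * \1_(g @^-1` [set y]) (phi w) : R).
  apply: measurable_funM => //.
  by apply: (measurableT_comp _ mphi); exact: measurable_indic.
(* True for every real [y]: the indicator vanishes unless [y] is a value of [g], hence
   nonnegative. *)
have yI0 (y : R) w : 0 <= y * (W w * \1_(g @^-1` [set y]) (phi w)).
  rewrite mulrCA mulr_ge0// indicE; case: (boolP (_ \in _)); last by rewrite mulr0.
  by rewrite inE /= mulr1 => <-.
under eq_integral => w _ do rewrite fimfunE.
transitivity (\int[mu]_w \sum_(y \in range g)
    (y * (W w * \1_(g @^-1` [set y]) (phi w)))%:E)%E.
  apply: eq_integral => w _; rewrite fsumEFin//; congr EFin.
  rewrite !fsbig_finite//= mulr_sumr; apply: eq_bigr => y _.
  by rewrite mulrCA.
rewrite ge0_integral_fsum//; last 2 first.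
- by move=> y; apply/measurable_EFinP; apply: measurable_funM.
- by move=> y w _; rewrite lee_fin.
apply: eq_fsbigr => y /[!inE] -[x _ <-].
under eq_integral => w _ do rewrite EFinM.
rewrite ge0_integralZl//; first exact/measurable_EFinP; last by rewrite lee_fin.
by move=> w _; rewrite lee_fin mulr_ge0.
Qed.

(** Extension from indicators to simple functions, then to nonnegative measurable [h] by monotone
    convergence. For a probability, taking [E] to be the whole space shows that [c] is the mean of
    [W]. *)
Lemma integral_mul_comp (R : realType) (d : measure_display)
    (T : measurableType d) (mu : {measure set T -> \bar R})
    (d' : measure_display) (T' : measurableType d') (W : T -> R) (phi : T -> T')
    (c : R) (h : T' -> R) :
  measurable_fun setT W -> measurable_fun setT phi -> measurable_fun setT h ->
  (forall w, 0 <= W w) -> 0 <= c -> (forall x, 0 <= h x) ->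
  (forall E : set T', measurable E ->
    \int[mu]_w (W w * \1_E (phi w))%:E = c%:E * \int[mu]_w (\1_E (phi w))%:E)%E ->
  (\int[mu]_w (W w * h (phi w))%:E = c%:E * \int[mu]_w (h (phi w))%:E)%E.
Proof.
move=> mW mphi mh W0 c0 h0 Wc.
have mh' : measurable_fun setT (EFin \o h) by exact/measurable_EFinP.
pose h_ := nnsfun_approx measurableT mh'.
have mh_ n : measurable_fun setT (fun w => h_ n (phi w)).
  exact: measurableT_comp.
(* Stated for any weight [V] because it serves twice: with [W] on the left and with the constant 1
   on the right. *)
have lim_h (V : T -> R) : measurable_fun setT V -> (forall w, 0 <= V w) ->
  (\int[mu]_w (V w * h_ n (phi w))%:E @[n --> \oo] -->
   \int[mu]_w (V w * h (phi w))%:E)%E.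
  move=> mV V0.
  rewrite [X in _ --> X](_ : _ =
      \int[mu]_w (limn (fun n => (V w * h_ n (phi w))%:E)))%E; last first.
    apply: eq_integral => w _; apply/esym/cvg_lim => //.
    under eq_fun do rewrite EFinM.
    rewrite EFinM; apply: cvgeZl => //.
    by apply: (@cvg_nnsfun_approx _ _ _ _ measurableT _ mh') => // x _; rewrite lee_fin.
  apply: cvg_monotone_convergence => //.
  - by move=> n; apply/measurable_EFinP/measurable_funM.
  - by move=> n w _; rewrite lee_fin mulr_ge0.
  - move=> w _ a b ab; rewrite lee_fin ler_wpM2l//.
    exact/lefP/nd_nnsfun_approx.
have lim1 := lim_h (cst 1) (measurable_cst _) (fun=> ler01).
have -> : (\int[mu]_w (h (phi w))%:E = \int[mu]_w (cst 1 w * h (phi w))%:E)%E.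
  by apply: eq_integral => w _; rewrite /= mul1r.
rewrite -(cvg_lim _ lim1)// -(cvg_lim _ (lim_h W mW W0))// -limeMl//; last first.
  by apply/cvg_ex; eexists; exact: lim1.
congr (limn _); apply/funext => n.
rewrite !integral_mul_nnsfun//.
(* Pulling [c] out of the sum requires nonnegative terms even at negative [y]; there the fibre of
   [h_ n] is empty and the integral is zero. *)
rewrite ge0_mule_fsumr; last first.
  move=> y; case: (leP 0 y) => y0.
    by rewrite mule_ge0// integral_ge0// => w _; rewrite lee_fin mul1r.
  have hy w : (cst 1 w * \1_(h_ n @^-1` [set y]) (phi w))%R = 0 :> R.
    rewrite indicE memNset ?mulr0//= => hy.
    by have : 0 <= h_ n (phi w); [by []|rewrite hy leNgt y0].
  by under eq_integral do rewrite hy; rewrite integral0 mule0.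
apply: eq_fsbigr => y _; rewrite Wc//.
by rewrite muleCA; under [in RHS]eq_integral do rewrite mul1r.
Qed.

End IntegralComposition.

Lemma measurable_forall_seq (d : measure_display) (T : measurableType d)
    (I : eqType) (s : seq I) (A : I -> set T) :
  (forall i, measurable (A i)) ->
  measurable [set w | forall i, i \in s -> A i w].
Proof.
move=> mA; elim: s => [|x s IH].
  by rewrite (_ : [set w | _] = setT)//; apply/seteqP; split.
rewrite (_ : [set w | _] = A x `&` [set w | forall i, i \in s -> A i w]).
  exact: measurableI.
apply/seteqP; split=> w /= => [Aw|[Ax As] i].
  by split=> [|i si]; apply: Aw; rewrite in_cons ?eqxx// si orbT.
by rewrite in_cons => /predU1P[->|/As].
Qed.

Lemma measurable_prod_comp (R : realType) (d : measure_display)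
    (Omega : measurableType d) (P : probability Omega R) (I : eqType)
    (Y : I -> {RV P >-> R}) (h : I -> R -> R) (s : seq I) :
  (forall i, measurable_fun setT (h i)) ->
  measurable_fun setT (fun w => \prod_(i <- s) h i (Y i w)).
Proof.
move=> mh; apply: (measurable_prod (h := fun i w => h i (Y i w))) => i _.
exact: measurableT_comp.
Qed.

Lemma independent_integral_prod (R : realType) (d : measure_display)
    (Omega : measurableType d) (P : probability Omega R) (I : eqType)
    (Y : I -> {RV P >-> R}) (h : I -> R -> R) (s : seq I) :
  mutually_independent Y -> uniq s ->
  (forall i, measurable_fun setT (h i)) -> (forall i x, 0 <= h i x) ->
  (forall i, \int[P]_w (h i (Y i w))%:E \is a fin_num)%E ->
  (\int[P]_w (\prod_(i <- s) h i (Y i w))%:E =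
   \prod_(i <- s) \int[P]_w (h i (Y i w))%:E)%E.
Proof.
move=> indY us mh h0 hfin.
(* The indicators are replaced by the functions [h i] one at a time. *)
suff mixed (s1 s2 : seq I) (E : I -> set R) : uniq (s1 ++ s2) ->
    (forall i, measurable (E i)) ->
    (\int[P]_w ((\prod_(i <- s1) h i (Y i w)) *
                \prod_(i <- s2) \1_(E i) (Y i w))%:E =
     (\prod_(i <- s1) \int[P]_w (h i (Y i w))%:E) *
     \prod_(i <- s2) P (Y i @^-1` E i))%E.
  have := mixed s [::] (fun=> setT); rewrite cats0 big_nil mule1 => <- //.
  by apply: eq_integral => w _; rewrite big_nil mulr1.
elim: s1 s2 E => [|x s1 IH] s2 E u12 mE.
  (* Only indicators remain: their product is the indicator of the joint event, to which
     independence applies. *)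
  rewrite big_nil mul1e -indY//.
  have mS : measurable [set w | forall i, i \in s2 -> E i (Y i w)].
    apply: measurable_forall_seq => i.
    by rewrite -[X in measurable X]setTI; exact: measurable_funP.
  rewrite -[in RHS](setIT [set w | _]) -integral_indic//.
  apply: eq_integral => w _; rewrite big_nil mul1r; congr EFin.
  rewrite indicE; case: (boolP (_ \in _)) => [/[!inE]/= Hw|].
    by rewrite big_seq big1// => i /Hw ?; rewrite indicE mem_set.
  rewrite notin_setE/= => /existsNP[i /not_implyP[is2 nE]].
  by rewrite (big_rem i)//= indicE memNset// mul0r.
move: u12; rewrite cat_cons /= => /andP[xs u12].
have /norP[xs1 xs2] : ~~ ((x \in s1) || (x \in s2)) by rewrite -mem_cat.
(* [W] gathers every factor except that of [x]; its mean [c] has to be finite to act as the real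
   constant of [integral_mul_comp]. *)
pose W w := (\prod_(i <- s1) h i (Y i w)) * \prod_(i <- s2) \1_(E i) (Y i w).
pose c : \bar R := ((\prod_(i <- s1) \int[P]_w (h i (Y i w))%:E) *
     \prod_(i <- s2) P (Y i @^-1` E i))%E.
have mprod (s' : seq I) (g : I -> R -> R) := @measurable_prod_comp R d Omega P I Y g s'.
have cfin : c \is a fin_num.
  apply: fin_numM; apply: prode_fin_num => // i _; apply: fin_num_measure.
  by rewrite -[X in measurable X]setTI; exact: measurable_funP.
have c0 : (0 <= c)%E.
  apply: mule_ge0; apply: prode_ge0 => // i _.
  by apply: integral_ge0 => w _; rewrite lee_fin.
rewrite big_cons -muleA -/c muleC -(fineK cfin).
rewrite -(@integral_mul_comp _ _ _ P _ _ W)//.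
- by apply: eq_integral => w _; rewrite /W big_cons -mulrA mulrC.
- rewrite /W; apply: measurable_funM; first exact: mprod.
  by apply: (mprod s2 (fun i => \1_(E i))) => i; exact: measurable_indic.
- by move=> w; rewrite mulr_ge0// prodr_ge0.
- exact: fine_ge0.
(* Moving [x] to the indicator side, with [E'] equal to [E0] at [x] and to [E] elsewhere, brings the
   claim under the induction hypothesis. *)
- move=> E0 mE0; pose E' i := if i == x then E0 else E i.
  have mE' i : measurable (E' i) by rewrite /E'; case: ifP.
  have E's (i : I) : i \in s2 -> E' i = E i.
    by move=> is2; rewrite /E' ifN//; apply: contraNneq xs2 => <-.
  have u' : uniq (s1 ++ x :: s2).
    by rewrite -cat1s uniq_catCA cat1s /= mem_cat negb_or xs1 xs2.
  have Ex : E' x = E0 by rewrite /E' eqxx.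
  transitivity (\int[P]_w ((\prod_(i <- s1) h i (Y i w)) *
      \prod_(i <- x :: s2) \1_(E' i) (Y i w))%:E)%E.
    apply: eq_integral => w _; congr EFin.
    rewrite /W big_cons Ex -mulrA; congr (_ * _); rewrite mulrC.
    by congr (_ * _); apply: eq_big_seq => i is2; rewrite E's.
  rewrite (IH _ _ u' mE') big_cons Ex muleCA fineK// [RHS]muleC; congr (_ * _)%E.
    have -> : (fun w => (\1_E0 (Y x w))%:E) = (fun w => (\1_(Y x @^-1` E0) w)%:E :> \bar R).
      by apply/funext => w; rewrite !indicE.
    rewrite integral_indic ?setIT//.
    by rewrite -[X in measurable X]setTI; exact: measurable_funP.
  by rewrite /c; congr (_ * _)%E; apply: eq_big_seq => i is2; rewrite E's.
Qed.

(** * Chernoff bound *)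

(** For [x >= 0] the partial sums of the exponential series increase to the limit; this is the one
    with three terms. *)
Lemma expR_ge1Dx2 (R : realType) (x : R) :
  0 <= x -> 1 + x + x ^+ 2 / 2 <= expR x.
Proof.
move=> x0; rewrite /expR.
have nd : nondecreasing_seq (series (exp_coeff x)).
  apply/nondecreasing_seqP => n; rewrite /series/= big_nat_recr//= lerDl.
  exact: exp_coeff_ge0.
have := nondecreasing_cvgn_le nd (is_cvg_series_exp_coeff x) 3%N.
rewrite /series/= !big_nat_recr//= big_nil /exp_coeff/= add0r.
by rewrite expr0 expr1 !divr1.
Qed.

(** After multiplication by [expR x >= 1 + x + x ^+ 2 / 2], the claim follows from the product of
    the two quadratics being [1 + x ^+ 4 / 4 >= 1]. *)
Lemma expRN_le (R : realType) (x : R) :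
  0 <= x -> expR (- x) <= 1 - x + x ^+ 2 / 2.
Proof.
move=> x0; have e0 := expR_gt0 x.
rewrite expRN -[_^-1]mul1r ler_pdivrMr//.
have q0 : 0 <= 1 - x + x ^+ 2 / 2 by nra.
apply: le_trans (ler_wpM2l q0 (expR_ge1Dx2 x0)).
have := sqr_ge0 (x ^+ 2); nra.
Qed.

Lemma mean_01 (R : realType) (d : measure_display) (Omega : measurableType d)
    (P : probability Omega R) (Z : Omega -> R) (nu : R) :
  measurable_fun setT Z -> (forall w, 0 <= Z w <= 1) ->
  (\int[P]_w (Z w)%:E = nu%:E)%E -> 0 <= nu <= 1.
Proof.
move=> mZ Z01 EZ; rewrite -!lee_fin -EZ; apply/andP; split.
  by apply: integral_ge0 => w _; rewrite lee_fin; case/andP: (Z01 w).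
rewrite -[leRHS](@probability_setT _ _ _ P) -[leRHS]mul1e -integral_cst//.
apply: ge0_le_integral => //; try by move=> w _; rewrite lee_fin; case/andP: (Z01 w).
exact/measurable_EFinP.
Qed.

(** Rewards lie in the unit interval only almost surely, while the exponential estimates are
    pointwise; truncation bridges the two without changing the mean. *)
Lemma clip_01 (R : realType) (d : measure_display) (Omega : measurableType d)
    (P : probability Omega R) (Z : {RV P >-> R}) (nu : R) :
  P (Z @^-1` `[0, 1]) = 1%E -> ('E_P[Z] = nu%:E)%E ->
  exists C : Omega -> R, [/\ measurable_fun setT C, forall w, 0 <= C w <= 1,
    ae_eq P setT (EFin \o Z) (EFin \o C) & (\int[P]_w (C w)%:E = nu%:E)%E].
Proof.
move=> Z01 EZ; pose C w := Num.min (Num.max (Z w) 0) 1.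
have mC : measurable_fun setT C.
  by apply: measurable_minr => //; exact: measurable_maxr.
have C01 w : 0 <= C w <= 1.
  by rewrite /C ge_min lexx orbT le_min ler01 andbT le_max lexx orbT.
have mD : measurable (Z @^-1` `[0, 1]).
  by rewrite -[X in measurable X]setTI; exact: measurable_funP.
have aeC : ae_eq P setT (EFin \o Z) (EFin \o C).
  exists (~` (Z @^-1` `[0, 1])); split; first exact: measurableC.
    by have := probability_setC P mD; rewrite Z01 subee.
  move=> w /= /not_implyP[_ ZC] Zw; apply: ZC => /=; congr EFin.
  by move: Zw; rewrite in_itv/= => /andP[Z0 Z1]; rewrite /C max_l// min_l.
exists C; split=> //; rewrite -EZ unlock; apply: ae_eq_integral => //.
- exact/measurable_EFinP.
- exact/measurable_EFinP.
- exact: ae_eq_sym.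
Qed.

(** Integrating [expRN_le] at [l * Z], with [Z ^+ 2 <= Z], bounds the uncentred integral by
    [1 - l * nu + l ^+ 2 / 2 * nu]. Then [nu <= 1] and [1 + u <= expR u] give the exponential
    form. *)
Lemma mgfN_le01 (R : realType) (d : measure_display) (Omega : measurableType d)
    (P : probability Omega R) (Z : Omega -> R) (nu l : R) :
  measurable_fun setT Z -> (forall w, 0 <= Z w <= 1) ->
  (\int[P]_w (Z w)%:E = nu%:E)%E -> 0 <= l ->
  (\int[P]_w (expR (- l * (Z w - nu)))%:E <= (expR (l ^+ 2 / 2))%:E)%E.
Proof.
move=> mZ Z01 EZ l0.
have Z0 w : 0 <= Z w by case/andP: (Z01 w).
have Z1 w : Z w <= 1 by case/andP: (Z01 w).
have nu01 := mean_01 mZ Z01 EZ.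
have mE : measurable_fun setT (fun w => expR (- l * Z w)).
  by apply: measurableT_comp => //; exact: measurable_funM.
have mEZ : measurable_fun setT (EFin \o Z) by exact/measurable_EFinP.
(* The linear term is placed on the side that keeps both integrands
   nonnegative. *)
have : (\int[P]_w ((expR (- l * Z w))%:E + l%:E * (Z w)%:E) <=
        \int[P]_w (1%:E + (l ^+ 2 / 2)%:E * (Z w)%:E))%E.
  apply: ge0_le_integral => //.
  - by move=> w _; rewrite -EFinM -EFinD lee_fin addr_ge0 ?expR_ge0 ?mulr_ge0.
  - apply: emeasurable_funD; first exact/measurable_EFinP.
    exact: measurable_funeM.
  - by apply: emeasurable_funD => //; exact: measurable_funeM.
  - move=> w _; rewrite -!EFinM -!EFinD lee_fin mulNr.
    have := expRN_le (mulr_ge0 l0 (Z0 w)).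
    have : (l * Z w) ^+ 2 <= l ^+ 2 * Z w.
      by rewrite exprMn ler_wpM2l ?sqr_ge0// expr2 ler_piMr.
    lra.
have lZ (k : R) : 0 <= k ->
    (\int[P]_w (k%:E * (Z w)%:E) = (k * nu)%:E)%E.
  by move=> k0; rewrite ge0_integralZl ?EZ// => w _; rewrite lee_fin.
have l20 : 0 <= l ^+ 2 / 2 by rewrite divr_ge0 ?sqr_ge0.
have addZ (g : Omega -> R) (k : R) : measurable_fun setT g ->
    (forall w, 0 <= g w) -> 0 <= k ->
    (\int[P]_w ((g w)%:E + k%:E * (Z w)%:E) =
     \int[P]_w (g w)%:E + (k * nu)%:E)%E.
  move=> mg g0 k0; rewrite ge0_integralD ?lZ//.
  - by move=> w _; rewrite lee_fin.
  - exact/measurable_EFinP.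
  - by move=> w _; rewrite -EFinM lee_fin mulr_ge0.
  - exact: measurable_funeM.
have cst1 : (\int[P]_w (cst 1 w)%:E = 1%:E :> \bar R)%E.
  by rewrite -[RHS](@probability_setT _ _ _ P) -[RHS]mul1e -integral_cst.
rewrite (addZ _ _ mE)// (addZ (cst 1))//.
rewrite cst1 -EFinD -leeBrDr// -EFinB.
move=> Hle.
have -> : (fun w => (expR (- l * (Z w - nu)))%:E) =
    (fun w => (expR (l * nu))%:E * (expR (- l * Z w))%:E)%E.
  by apply/funext => w; rewrite -EFinM -expRD; congr (expR _)%:E; ring.
rewrite ge0_integralZl//; last exact/measurable_EFinP.
apply: le_trans (lee_wpmul2l _ Hle) _; first by rewrite lee_fin expR_ge0.
rewrite -EFinM lee_fin.
rewrite [leRHS](_ : _ = expR (l * nu) * expR (l ^+ 2 / 2 - l * nu)); last first.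
  by rewrite -expRD; congr expR; ring.
rewrite ler_wpM2l ?expR_ge0//; apply: le_trans (expR_ge1Dx _).
by case/andP: nu01 => nu0 nu1; nra.
Qed.

(** Positive [l] reduces to the previous case by reflection: [1 - Z] is again valued in the unit
    interval, with mean [1 - nu], and centring it gives the opposite of [Z - nu]. *)
Lemma mgf_le01 (R : realType) (d : measure_display) (Omega : measurableType d)
    (P : probability Omega R) (Z : Omega -> R) (nu l : R) :
  measurable_fun setT Z -> (forall w, 0 <= Z w <= 1) ->
  (\int[P]_w (Z w)%:E = nu%:E)%E ->
  (\int[P]_w (expR (l * (Z w - nu)))%:E <= (expR (l ^+ 2 / 2))%:E)%E.
Proof.
move=> mZ Z01 EZ; case: (leP l 0) => l0.
  by have := mgfN_le01 mZ Z01 EZ (l := - l); rewrite opprK sqrrN oppr_ge0; apply.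
have m1Z : measurable_fun setT (fun w => 1 - Z w) by exact: measurable_funB.
have Z01' w : 0 <= 1 - Z w <= 1 by have := Z01 w; lra.
have EZ' : (\int[P]_w (1 - Z w)%:E = (1 - nu)%:E)%E.
  have : (\int[P]_w ((Z w)%:E + (1 - Z w)%:E) = 1)%E.
    under eq_integral => w _ do rewrite -EFinD subrKC.
    by rewrite -[RHS](@probability_setT _ _ _ P) -[RHS]mul1e -integral_cst.
  rewrite ge0_integralD//; try exact/measurable_EFinP; last 2 first.
  - by move=> w _; rewrite lee_fin; case/andP: (Z01 w).
  - by move=> w _; rewrite lee_fin; case/andP: (Z01' w).
  by rewrite EZ EFinB => <-; rewrite [X in (X - _)%E]addeC addeK.
have := mgfN_le01 m1Z Z01' EZ' (ltW l0); apply: le_trans.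
by rewrite le_eqVlt; apply/orP; left; apply/eqP; apply: eq_integral => w _;
  congr (expR _)%:E; ring.
Qed.

Lemma mgf_le (R : realType) (d : measure_display) (Omega : measurableType d)
    (P : probability Omega R) (Z : {RV P >-> R}) (nu l : R) :
  P (Z @^-1` `[0, 1]) = 1%E -> ('E_P[Z] = nu%:E)%E ->
  (\int[P]_w (expR (l * (Z w - nu)))%:E <= (expR (l ^+ 2 / 2))%:E)%E.
Proof.
move=> Z01 /(clip_01 Z01)[C [mC C01 aeC EC]].
have mexp (g : Omega -> R) : measurable_fun setT g ->
    measurable_fun setT (EFin \o (fun w => expR (l * (g w - nu)))).
  move=> mg; apply/measurable_EFinP/measurableT_comp => //.
  by apply: measurable_funM => //; exact: measurable_funB.
rewrite (ae_eq_integral (EFin \o (fun w => expR (l * (C w - nu)))))//.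
- exact: mgf_le01.
- exact: mexp.
- exact: mexp.
- apply: filterS aeC => w /[apply] -[ZC].
  by rewrite /= ZC.
Qed.

(* Chernoff's bound; [l] may have either sign, so it covers both tails. *)
Lemma independent_sum_tail (R : realType) (d : measure_display)
    (Omega : measurableType d) (P : probability Omega R) (I : eqType)
    (Y : I -> {RV P >-> R}) (nu l a : R) (s : seq I) :
  mutually_independent Y -> uniq s ->
  (forall i, P (Y i @^-1` `[0, 1]) = 1%E) -> (forall i, 'E_P[Y i] = nu%:E)%E ->
  (P [set w | (a <= l * \sum_(i <- s) (Y i w - nu))%R] <=
   (expR ((size s)%:R * (l ^+ 2 / 2) - a))%:E)%E.
Proof.
move=> indY us Y01 EY.
pose h (i : I) x := expR (l * (x - nu)).
have mh i : measurable_fun setT (h i).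
  apply: measurableT_comp => //; apply: measurable_funM => //.
  exact: measurable_funB.
have le_h i : (\int[P]_w (h i (Y i w))%:E <= (expR (l ^+ 2 / 2))%:E)%E.
  exact: mgf_le.
have h0 i : (0 <= \int[P]_w (h i (Y i w))%:E)%E.
  by apply: integral_ge0 => w _; rewrite lee_fin expR_ge0.
have hprod w : \prod_(i <- s) h i (Y i w) = expR (l * \sum_(i <- s) (Y i w - nu)).
  by rewrite mulr_sumr expR_sum.
have mprod : measurable_fun setT (fun w => \prod_(i <- s) h i (Y i w)).
  exact: measurable_prod_comp.
have mS : measurable [set w | a <= l * \sum_(i <- s) (Y i w - nu)].
  rewrite -[X in measurable X]setTI; apply: measurable_fun_le => //.
  apply: measurable_funM => //; apply: measurable_sum => i.
  exact: measurable_funB.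
rewrite -[X in P X]setIT -integral_indic//.
(* Markov's inequality in pointwise form: the indicator of the event is at most [expR (l * S - a)],
   with [S] the centred sum. *)
apply: (@le_trans _ _ (\int[P]_w ((expR (- a))%:E * (\prod_(i <- s) h i (Y i w))%:E))%E).
  apply: ge0_le_integral => //.
  - exact/measurable_EFinP/measurable_indic.
  - by apply: measurable_funeM; exact/measurable_EFinP.
  - move=> w _; rewrite -EFinM lee_fin hprod -expRD indicE.
    case: (boolP (_ \in _)) => [/[!inE]/= aS|_]; last exact: expR_ge0.
    by rewrite -[leLHS]expR0 ler_expR addrC subr_ge0.
rewrite ge0_integralZl//; last 2 first.
- exact/measurable_EFinP.
- by move=> w _; rewrite lee_fin prodr_ge0// => i _; exact: expR_ge0.
rewrite independent_integral_prod//; last 2 first.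
- by move=> i x; exact: expR_ge0.
- by move=> i; rewrite ge0_fin_numE// (le_lt_trans (le_h i))// ltry.
rewrite addrC expRD EFinM; apply: lee_wpmul2l; first by rewrite lee_fin expR_ge0.
rewrite expRM_natl.
elim: s {us hprod mprod mS} => [|x s IH]; first by rewrite big_nil expr0.
by rewrite big_cons [expR _ ^+ _]exprS EFinM lee_pmul// prode_ge0.
Qed.

(** * Concentration of the empirical means *)

(** Used to isolate the rewards of a single arm. The left inverse [g] turns sets indexed by [J] into
    sets indexed by [I]. *)
Lemma mutually_independent_comp (R : realType) (d : measure_display)
    (Omega : measurableType d) (P : probability Omega R) (I J : eqType)
    (Y : I -> {RV P >-> R}) (f : J -> I) (g : I -> J) :
  cancel f g -> mutually_independent Y ->
  mutually_independent (fun j => Y (f j)).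
Proof.
move=> fK indY s E us mE.
have := indY [seq f j | j <- s] (fun i => E (g i)).
rewrite big_map map_inj_uniq; last exact: can_inj fK.
under [in X in _ -> _ -> _ = X]eq_bigr => j _ do rewrite fK.
move=> /(_ us (fun i => mE (g i))) <-; congr (P _).
apply/seteqP; split=> w /= Ew.
  by move=> _ /mapP[j js ->]; rewrite fK; exact: Ew.
by move=> j js; have := Ew _ (map_f f js); rewrite fK.
Qed.

Lemma measurable_deviation (R : realType) (d : measure_display)
    (Omega : measurableType d) (P : probability Omega R)
    (Y : nat -> {RV P >-> R}) (nu c : R) (n : nat) :
  measurable [set w | `|\sum_(0 <= k < n) (Y k w - nu)| <= c].
Proof.
rewrite -[X in measurable X]setTI; apply: measurable_fun_le => //.
apply: measurableT_comp => //; apply: measurable_sum => k.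
exact: measurable_funB.
Qed.

Lemma bandit_deviation (R : realType) (d : measure_display)
    (Omega : measurableType d) (P : probability Omega R) (K : nat)
    (mu : 'I_K -> R) (X : 'I_K -> nat -> {RV P >-> R}) (i : 'I_K) (n : nat)
    (L : R) :
  stochastic_bandit mu X -> 0 <= L -> (0 < n)%N ->
  (P (~` [set w | (`|\sum_(0 <= k < n) (X i k w - mu i)| <=
                   n%:R * Num.sqrt (2 * L / n%:R))%R]) <=
   (2 * expR (- L))%:E)%E.
Proof.
move=> hX L0 n0; set e := Num.sqrt _.
have e0 : 0 <= e by exact: sqrtr_ge0.
have ne2 : n%:R * e ^+ 2 = 2 * L.
  rewrite sqr_sqrtr ?divr_ge0 ?mulr_ge0// mulrC divfK//.
  by rewrite pnatr_eq0 -lt0n.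
have indX : mutually_independent (fun k => X i k).
  have fK : cancel (fun k : nat => (i, k)) snd by [].
  exact: (mutually_independent_comp fK (reward_indep hX)).
(* The slope is [e] or [- e], and the threshold is [n * e ^+ 2 = 2 * L], so the Chernoff exponent is
   [L - 2 * L = - L]. *)
have tail l : l ^+ 2 = e ^+ 2 ->
    (P [set w | (2 * L <= l * \sum_(0 <= k < n) (X i k w - mu i))%R] <=
     (expR (- L))%:E)%E.
  move=> l2; apply: le_trans (independent_sum_tail l (2 * L) indX (iota_uniq 0 _)
    (reward_support hX i) (reward_mean hX i)) _.
  rewrite lee_fin ler_expR size_iota subn0 l2 mulrA ne2; lra.
have mT l : measurable
    [set w | (2 * L <= l * \sum_(0 <= k < n) (X i k w - mu i))%R].
  rewrite -[X in measurable X]setTI; apply: measurable_fun_le => //.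
  apply: measurable_funM => //; apply: measurable_sum => k.
  exact: measurable_funB.
rewrite mulrDl mul1r EFinD.
apply: le_trans (leeD (tail e erefl) (tail (- e) (sqrrN e))).
apply: le_trans (measureU2 _ _ _); [|exact: mT..].
apply: le_measure; rewrite ?inE.
- by apply: measurableC; exact: measurable_deviation.
- by apply: measurableU.
move=> w /=; set S := \sum_(_ <= _ < _) _ => /negP; rewrite -ltNge => eS.
have e2S : 2 * L <= e * `|S|.
  by rewrite -ne2 expr2 mulrCA; apply: ler_wpM2l => //; exact: ltW.
case: (leP 0 S) => S0; [left|right].
  by rewrite -(ger0_norm S0).
by move: e2S; rewrite ltr0_norm// mulrN mulNr.
Qed.

Lemma union_bound (R : realType) (d : measure_display)
    (Omega : measurableType d) (P : probability Omega R) (I : eqType)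
    (s : seq I) (A : I -> set Omega) (c : R) :
  (forall i, measurable (A i)) ->
  (forall i, i \in s -> (P (~` A i) <= c%:E)%E) ->
  ((1 - (size s)%:R * c)%:E <= P [set w | forall i, i \in s -> A i w])%E.
Proof.
move=> mA; suff Hc (s' : seq I) : (forall i, i \in s' -> (P (~` A i) <= c%:E)%E) ->
    (P (~` [set w | forall i, i \in s' -> A i w]) <= ((size s')%:R * c)%:E)%E.
  move=> Ac; have mS := @measurable_forall_seq _ _ _ s A mA.
  have := Hc s Ac; rewrite probability_setC//.
  rewrite -(@fineK _ (P [set w | _])) ?fin_num_measure// -EFinB !lee_fin; lra.
elim: s' => [|x s' IH] Ac.
  rewrite (_ : [set w | _] = setT) ?setCT ?measure0 ?mul0r//.
  by apply/seteqP; split.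
have -> : ~` [set w | forall i, i \in x :: s' -> A i w] =
    ~` A x `|` ~` [set w | forall i, i \in s' -> A i w].
  rewrite -setCI; congr (~` _); apply/seteqP; split=> w /= => [Aw|[Ax As] i].
    by split=> [|i si]; apply: Aw; rewrite in_cons ?eqxx// si orbT.
  by rewrite in_cons => /predU1P[->|/As].
have mS := @measurable_forall_seq _ _ _ s' A mA.
apply: le_trans (measureU2 _ _ _) _; [exact: measurableC..|].
rewrite /= -natr1 mulrDl mul1r addrC EFinD; apply: leeD.
  by apply: IH => i is'; apply: Ac; rewrite in_cons is' orbT.
by apply: Ac; rewrite mem_head.
Qed.

(** Phrased on the reward table rather than on a run, and uniformly in [n]: the bound can then be
    used at the random, history-dependent pull counts of the algorithm. *)
Definition concentrated (R : realType) (K : nat) (mu : 'I_K -> R) (L : R)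
    (T : nat) (x : 'I_K -> nat -> R) : Prop :=
  forall i n, (0 < n <= T)%N ->
    `|\sum_(0 <= k < n) (x i k - mu i)| <= n%:R * Num.sqrt (2 * L / n%:R).

Lemma log_factor_ge0 (R : realType) (K T : nat) (eta : R) :
  (0 < K)%N -> 0 < eta < 1 -> 0 <= log_factor K T eta.
Proof.
move=> K0 /andP[eta0 eta1]; rewrite /log_factor.
(* [ln 0 = 0] *)
have [->|T0] := posnP T; first by rewrite mulr0 mul0r ln0.
have K1 : (1 : R) <= K%:R by rewrite ler1n.
have T1 : (1 : R) <= T%:R by rewrite ler1n.
have KT1 : 1 <= K%:R * T%:R :> R by rewrite mulr_ege1.
by rewrite ln_ge0// ler_pdivlMr// mul1r; nra.
Qed.

Lemma concentrated_probability (R : realType) (d : measure_display)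
    (Omega : measurableType d) (P : probability Omega R) (K : nat)
    (mu : 'I_K -> R) (X : 'I_K -> nat -> {RV P >-> R}) (i0 : 'I_K) (T : nat)
    (eta : R) :
  stochastic_bandit mu X -> 0 < eta < 1 ->
  let G := [set w | concentrated mu (log_factor K T eta) T
                      (fun i n => X i n w)] in
  measurable G /\ ((1 - eta)%:E <= P G)%E.
Proof.
move=> hX /andP[eta0 eta1] G; pose L := log_factor K T eta.
pose A (p : 'I_K * nat) := [set w |
  `|\sum_(0 <= k < p.2) (X p.1 k w - mu p.1)| <= p.2%:R * Num.sqrt (2 * L / p.2%:R)].
pose s := [seq (i, n) | i <- enum 'I_K, n <- iota 1 T].
have GE : G = [set w | forall p, p \in s -> A p w].
  apply/seteqP; split=> w /= Gw.
    move=> _ /allpairsP[[i n] /= [_ nT ->]]; apply: Gw.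
    by move: nT; rewrite mem_iota add1n ltnS.
  move=> i n nT; apply: (Gw (i, n)); apply/allpairsP; exists (i, n); split=> //=.
    by rewrite mem_enum.
  by rewrite mem_iota add1n ltnS.
have mA p : measurable (A p) by exact: measurable_deviation.
have ss : size s = (K * T)%N by rewrite size_allpairs size_enum_ord size_iota.
rewrite GE; split; first exact: measurable_forall_seq.
apply: le_trans (union_bound (c := 2 * expR (- L)) mA _); last first.
  move=> p /allpairsP[[i n] /= [_ nT ->]].
  move: nT; rewrite mem_iota add1n ltnS => /andP[n0 nT].
  apply: bandit_deviation => //; apply: log_factor_ge0; last exact/andP.
  exact: leq_ltn_trans (ltn_ord i0).
(* There are [K * T] deviation events, each failing with probability at most
   [2 * expR (- L) = eta / (K * T)], for a total of [eta]; for [T = 0] there is none. *)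
rewrite lee_fin lerD2l lerN2 ss.
have [->|T0] := posnP T; first by rewrite muln0 mul0r ltW.
have K0 : 0 < K%:R :> R by rewrite ltr0n (leq_ltn_trans _ (ltn_ord i0)).
have T0' : 0 < T%:R :> R by rewrite ltr0n.
rewrite /L /log_factor expRN lnK ?posrE ?divr_gt0 ?mulr_gt0// natrM.
rewrite le_eqVlt; apply/orP; left; apply/eqP; field.
by rewrite !gt_eqF.
Qed.

(** * Measurability of the regret events *)

Lemma measurable_fun_fin (R : realType) (d : measure_display)
    (Omega : measurableType d) (K : nat) (f : Omega -> 'I_K) (h : 'I_K -> R) :
  (forall i, measurable [set w | f w = i]) ->
  measurable_fun setT (fun w => h (f w)).
Proof.
(* A function of a variable with finitely many values is a combination of indicators of its
   fibres. *)
move=> mf; have -> : (fun w => h (f w)) =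
    (fun w => \sum_(i < K) h i * \1_[set w | f w = i] w).
  apply/funext => w; rewrite (bigD1 (f w))//= indicE mem_set// mulr1.
  rewrite big1 ?addr0// => i /eqP fi; rewrite indicE memNset ?mulr0// => /= wi.
  exact: fi.
by apply: measurable_sum => i; exact: measurable_funM.
Qed.

Lemma measurable_fair_regret (R : realType) (d : measure_display)
    (Omega : measurableType d) (K B : nat) (H : 'I_B -> nat)
    (m : 'I_B -> 'I_K -> nat) (mu : 'I_K -> R) (istar : 'I_K)
    (A : nat -> Omega -> 'I_K) (c : R) :
  (forall t i, measurable [set w | A t w = i]) ->
  measurable [set w | fair_regret H m mu istar (fun t => A t w) <= c].
Proof.
move=> mA; rewrite -[X in measurable X]setTI; apply: measurable_fun_le => //.
apply: measurable_funB => //; apply: measurable_sum => t.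
exact: measurable_fun_fin.
Qed.

(** * Regret of a run *)

(** The existential over blocks makes this a predicate on global rounds, with no need to compute the
    block of [t]. *)
Definition residual_round (B K : nat) (H : 'I_B -> nat)
    (m : 'I_B -> 'I_K -> nat) (t : nat) : bool :=
  [exists b, (block_start H b + floor_total m b <= t < block_start H b + H b)%N].

Definition residual_pulls (B K : nat) (H : 'I_B -> nat)
    (m : 'I_B -> 'I_K -> nat) (a : nat -> 'I_K) (i : 'I_K) : nat :=
  (\sum_(0 <= t < horizon H) (residual_round H m t && (a t == i)))%N.

(** By induction, splitting off the last block: its length does not enter the starts of the earlier
    ones. *)
Lemma sum_blocks (V : nmodType) (B : nat) (H : 'I_B -> nat) (F : nat -> V) :
  \sum_(0 <= t < horizon H) F t =
  \sum_(b < B) \sum_(block_start H b <= t < block_start H b + H b) F t.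
Proof.
elim: B H => [|B IH] H; first by rewrite /horizon !big_ord0 big_nil.
pose H' b := H (widen_ord (leqnSn B) b).
have startE b : block_start H (widen_ord (leqnSn B) b) = block_start H' b.
  by rewrite /block_start big_mkcond big_ord_recr -big_mkcond/= ltnNge ltnW ?addn0.
have start_max : block_start H ord_max = horizon H'.
  rewrite /block_start /horizon big_mkcond big_ord_recr/= ltnn addn0.
  by apply: eq_bigr => b _; rewrite ltn_ord.
have hE : horizon H = (horizon H' + H ord_max)%N by rewrite /horizon big_ord_recr.
rewrite big_ord_recr/= start_max hE (big_cat_nat _ (leq_addr _ _))//= IH.
by congr (_ + _); apply: eq_bigr => b _; rewrite startE.
Qed.

Lemma block_end_le_start (B : nat) (H : 'I_B -> nat) (b c : 'I_B) :
  (b < c)%N -> (block_start H b + H b <= block_start H c)%N.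
Proof.
move=> bc; rewrite /block_start [leqRHS](bigD1 b)//= addnC leq_add2l.
rewrite big_mkcond [leqRHS]big_mkcond/=; apply: leq_sum => e _.
case: ltnP => // eb; rewrite (ltn_trans eb bc)/= ifT//.
by apply: contraTneq eb => ->; rewrite ltnn.
Qed.

(** Blocks are disjoint, so the only possible witness of the existential is [b] itself. *)
Lemma residual_round_block (B K : nat) (H : 'I_B -> nat)
    (m : 'I_B -> 'I_K -> nat) (b : 'I_B) (t : nat) :
  (block_start H b <= t < block_start H b + H b)%N ->
  residual_round H m t = (block_start H b + floor_total m b <= t)%N.
Proof.
move=> /andP[bt tb]; apply/existsP/idP => [[c /andP[ct tc]]|bt'].
  have [bc|cb|/val_inj -> //] := ltngtP b c.
    by have := @block_end_le_start _ H b c bc; lia.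
  by have := @block_end_le_start _ H c b cb; lia.
by exists b; rewrite bt' tb.
Qed.

Lemma sum_residual (V : nmodType) (B K : nat) (H : 'I_B -> nat)
    (m : 'I_B -> 'I_K -> nat) (F : nat -> V) :
  (forall b, (floor_total m b <= H b)%N) ->
  \sum_(0 <= t < horizon H | residual_round H m t) F t =
  \sum_(b < B) \sum_(block_start H b + floor_total m b <= t <
                     block_start H b + H b) F t.
Proof.
move=> hm; rewrite big_mkcond sum_blocks; apply: eq_bigr => b _.
rewrite (@big_cat_nat _ _ _ (block_start H b + floor_total m b))/=;
  rewrite ?leq_addr ?leq_add2l//.
rewrite [X in X + _]big_nat big1 ?add0r => [|t /andP[bt tb]]; last first.
  rewrite (@residual_round_block _ _ _ _ b).
    by rewrite leqNgt tb.
  by rewrite bt (leq_trans tb)// leq_add2l.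
apply: eq_big_nat => t /andP[bt tb]; rewrite (@residual_round_block _ _ _ _ b) ?bt//.
by rewrite (leq_trans (leq_addr _ _) bt).
Qed.

(** Exchanging the sums counts each residual round once, through the arm pulled in it. *)
Lemma sum_residual_pulls (B K : nat) (H : 'I_B -> nat)
    (m : 'I_B -> 'I_K -> nat) (a : nat -> 'I_K) :
  (forall b, (floor_total m b <= H b)%N) ->
  (\sum_(i < K) residual_pulls H m a i)%N = residual H m.
Proof.
move=> hm; rewrite exchange_big/=.
transitivity (\sum_(0 <= t < horizon H | residual_round H m t) 1)%N.
  rewrite [RHS]big_mkcond; apply: eq_bigr => t _; case: ifP => // _.
    rewrite (bigD1 (a t))//= eqxx big1// => i /negPf.
    by rewrite eq_sym => ->.
  by rewrite big1.
rewrite (@sum_residual nat)//; apply: eq_bigr => b _.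
by rewrite sum_nat_const_nat muln1 subnDl.
Qed.

Lemma sum_count_mem (V : pzRingType) (I : finType) (s : seq I) (F : I -> V) :
  \sum_(i <- s) F i = \sum_i (count_mem i s)%:R * F i.
Proof.
elim: s => [|x s IH].
  by rewrite big_nil big1// => i _; rewrite mul0r.
rewrite big_cons IH (bigD1 x)//= [in RHS](bigD1 x)//= eqxx natrD mulrDl mul1r.
rewrite addrA; congr (_ + _); apply: eq_bigr => i /negPf ix.
by rewrite eq_sym ix.
Qed.

(** [F] takes values in any [nmodType], since both pull counts and gaps are summed this way. *)
Lemma sum_mandatory (V : nmodType) (R : realType) (B K : nat) (H : 'I_B -> nat)
    (m : 'I_B -> 'I_K -> nat) (order : 'I_B -> seq 'I_K) (L : R)
    (x : 'I_K -> nat -> R) (a : nat -> 'I_K) (b : 'I_B) (F : 'I_K -> V) :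
  bdq_ucb_run H m order L x a ->
  \sum_(block_start H b <= t < block_start H b + floor_total m b) F (a t) =
  \sum_(i <- order b) F i.
Proof.
move=> run; rewrite -(run_mandatory run) big_map.
by rewrite /index_iota addKn.
Qed.

Lemma floor_le_block_pulls (R : realType) (B K : nat) (H : 'I_B -> nat)
    (m : 'I_B -> 'I_K -> nat) (order : 'I_B -> seq 'I_K) (L : R)
    (x : 'I_K -> nat -> R) (a : nat -> 'I_K) (b : 'I_B) (i : 'I_K) :
  (forall b, (floor_total m b <= H b)%N) -> mandatory_order m order ->
  bdq_ucb_run H m order L x a -> (m b i <= block_pulls H a b i)%N.
Proof.
move=> hm horder run; rewrite /block_pulls /pulls.
rewrite (@big_cat_nat _ _ _ (block_start H b + floor_total m b))/=;
  rewrite ?leq_addr ?leq_add2l//.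
rewrite (@sum_mandatory nat R B K H m order L x a b (fun j => (j == i) : nat) run).
by rewrite -(horder b i) -sum1_count big_mkcond; exact: leq_addr.
Qed.

Lemma fair_regretE (R : realType) (B K : nat) (H : 'I_B -> nat)
    (m : 'I_B -> 'I_K -> nat) (order : 'I_B -> seq 'I_K) (L : R)
    (mu : 'I_K -> R) (istar : 'I_K) (x : 'I_K -> nat -> R) (a : nat -> 'I_K) :
  (forall b, (floor_total m b <= H b)%N) -> mandatory_order m order ->
  bdq_ucb_run H m order L x a ->
  fair_regret H m mu istar a =
  \sum_(i < K) (residual_pulls H m a i)%:R * gap mu istar i.
Proof.
move=> hm horder run.
have -> : \sum_(i < K) (residual_pulls H m a i)%:R * gap mu istar i =
    \sum_(0 <= t < horizon H | residual_round H m t) gap mu istar (a t).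
  under eq_bigr => i _ do rewrite natr_sum mulr_suml.
  rewrite exchange_big/= [RHS]big_mkcond; apply: eq_bigr => t _.
  case: ifP => _; last by rewrite big1// => i _; rewrite mul0r.
  rewrite (bigD1 (a t))//= eqxx mul1r big1 ?addr0// => i /negPf.
  by rewrite eq_sym => ->; rewrite mul0r.
(* The deduction made in the fair optimum is exactly the total gap of the mandatory rounds; the
   omitted arm [istar] has gap zero. *)
have mandatoryE : \sum_(b < B) \sum_(i < K | i != istar) (m b i)%:R * gap mu istar i =
    \sum_(b < B) \sum_(block_start H b <= t < block_start H b + floor_total m b)
      gap mu istar (a t).
  apply: eq_bigr => b _; rewrite (sum_mandatory _ _ run) sum_count_mem.
  rewrite [RHS](bigD1 istar)//= {2}/gap subrr mulr0 add0r.
  by apply: eq_bigr => i _; rewrite horder.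
rewrite /fair_regret /opt_value mandatoryE addrAC.
have -> : (horizon H)%:R * mu istar - \sum_(0 <= t < horizon H) mu (a t) =
    \sum_(0 <= t < horizon H) gap mu istar (a t).
  by rewrite /gap sumrB sumr_const_nat subn0 mulr_natl.
rewrite sum_blocks sum_residual// -sumrB; apply: eq_bigr => b _.
rewrite (@big_cat_nat _ _ _ (block_start H b + floor_total m b))/=;
  rewrite ?leq_addr ?leq_add2l//.
by rewrite [LHS]addrC addKr.
Qed.

(** Each pull of arm [i] reads the next entry of its row, so an adaptive sum becomes an initial
    segment of that row, as in [concentrated]. *)
Lemma sum_observed_reward (R : realType) (K : nat) (x : 'I_K -> nat -> R)
    (a : nat -> 'I_K) (i : 'I_K) (t : nat) :
  \sum_(0 <= u < t | a u == i) observed_reward x a u =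
  \sum_(0 <= k < pulls a i 0 t) x i k.
Proof.
elim: t => [|t IH]; first by rewrite /pulls !big_geq.
rewrite big_mkcond big_nat_recr// -big_mkcond/= IH.
rewrite {2}/pulls big_nat_recr//= -/(pulls a i 0 t).
case: eqP => [<-|_]; last by rewrite addn0 addr0.
by rewrite addn1 big_nat_recr.
Qed.

Lemma empirical_mean_deviation (R : realType) (K : nat) (mu : 'I_K -> R)
    (L : R) (T : nat) (x : 'I_K -> nat -> R) (a : nat -> 'I_K) (i : 'I_K)
    (t : nat) :
  concentrated mu L T x -> (0 < pulls a i 0 t <= T)%N ->
  `|empirical_mean x a i t - mu i| <= Num.sqrt (2 * L / (pulls a i 0 t)%:R).
Proof.
move=> conc; rewrite /empirical_mean sum_observed_reward.
move: (pulls _ _ _ _) => n nT; have := conc i n nT.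
have n0 : 0 < n%:R :> R by case/andP: nT; rewrite ltr0n.
rewrite sumrB sumr_const_nat subn0 => Hd.
rewrite -(ler_pM2l n0); apply: le_trans Hd.
rewrite -[X in X * _](ger0_norm (ltW n0)) -normrM mulrBr mulrCA divff ?gt_eqF//.
by rewrite mulr1 mulr_natl.
Qed.

Lemma pulls_le (K : nat) (a : nat -> 'I_K) (i : 'I_K) (t : nat) :
  (pulls a i 0 t <= t)%N.
Proof.
by rewrite -[leqRHS]subn0 -[leqRHS]muln1 -sum_nat_const_nat; apply: leq_sum => u _; case: eqP.
Qed.

Lemma residual_gap_le (R : realType) (B K : nat) (H : 'I_B -> nat)
    (m : 'I_B -> 'I_K -> nat) (order : 'I_B -> seq 'I_K) (L : R)
    (mu : 'I_K -> R) (istar : 'I_K) (x : 'I_K -> nat -> R) (a : nat -> 'I_K)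
    (t : nat) :
  bdq_ucb_run H m order L x a -> concentrated mu L (horizon H) x ->
  (t < horizon H)%N -> residual_round H m t -> (0 < pulls a (a t) 0 t)%N ->
  gap mu istar (a t) <= 2 * Num.sqrt (2 * L / (pulls a (a t) 0 t)%:R).
Proof.
move=> run conc tT /existsP[b bt] N0.
have := run_residual run bt istar; rewrite /ucb_index (gtn_eqF N0).
(* If the best arm were still unpulled, its infinite index would exceed the finite index of the arm
   chosen. *)
case: (posnP (pulls a istar 0 t)) => [//|Ns0]; rewrite lee_fin => ucb.
have le_T i : (pulls a i 0 t <= horizon H)%N.
  by rewrite (leq_trans (pulls_le _ _ _))// ltnW.
have dev i : (0 < pulls a i 0 t)%N ->
    `|empirical_mean x a i t - mu i| <= Num.sqrt (2 * L / (pulls a i 0 t)%:R).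
  by move=> i0; apply: (empirical_mean_deviation conc); rewrite i0 le_T.
have /ler_normlP[ds _] := dev _ Ns0; have /ler_normlP[_ dt] := dev _ N0.
by rewrite /gap; lra.
Qed.

(** The successor separates the last occurrence from the earlier ones; it is the source of the [.-1]
    in the bounds on residual pulls. *)
Lemma last_occurrence (p : pred nat) (T : nat) :
  (0 < \sum_(0 <= t < T) p t)%N ->
  exists t, [/\ (t < T)%N, p t &
    (\sum_(0 <= u < T) p u = (\sum_(0 <= u < t) p u).+1)%N].
Proof.
elim: T => [|T IH]; first by rewrite big_geq.
rewrite big_nat_recr//=; case pT: (p T) => /=; last first.
  rewrite addn0 => /IH[t [tT pt ->]]; exists t; split=> //.
  by rewrite ltnS ltnW.
by move=> _; exists T; split=> //; rewrite addn1.
Qed.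

(** At the last residual pull of [i], all earlier residual pulls are included in the total count of
    [i], and the confidence radius decreases with that count. *)
Lemma residual_pulls_gap (R : realType) (B K : nat) (H : 'I_B -> nat)
    (m : 'I_B -> 'I_K -> nat) (order : 'I_B -> seq 'I_K) (L : R)
    (mu : 'I_K -> R) (istar : 'I_K) (x : 'I_K -> nat -> R) (a : nat -> 'I_K)
    (i : 'I_K) :
  bdq_ucb_run H m order L x a -> concentrated mu L (horizon H) x -> 0 <= L ->
  (0 < (residual_pulls H m a i).-1)%N ->
  gap mu istar i <= 2 * Num.sqrt (2 * L / (residual_pulls H m a i).-1%:R).
Proof.
move=> run conc L0 n0.
have [t [tT /andP[rt /eqP ai] nE]] := @last_occurrence
  (fun t => residual_round H m t && (a t == i)) (horizon H) (leq_trans n0 (leq_pred _)).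
have nN : ((residual_pulls H m a i).-1 <= pulls a i 0 t)%N.
  by rewrite /residual_pulls nE/=; apply: leq_sum => u _; case: (residual_round _ _ _).
have N0 : (0 < pulls a i 0 t)%N := leq_trans n0 nN.
rewrite -{1}ai; apply: le_trans (residual_gap_le istar run conc tT rt _) _.
  by rewrite ai.
rewrite ai ler_wpM2l// ler_wsqrtr// ler_wpM2l ?mulr_ge0//.
by rewrite lef_pV2 ?posrE ?ltr0n// ler_nat.
Qed.

(** Cauchy-Schwarz against the constant 1, read off from the nonnegative sum of the squares of
    [#|I| * f i - S]. *)
Lemma sqr_sum_le (R : realFieldType) (I : finType) (f : I -> R) :
  (\sum_i f i) ^+ 2 <= #|I|%:R * \sum_i f i ^+ 2.
Proof.
have [I0|I0] := posnP #|I|.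
  by rewrite I0 mul0r big1 ?expr0n// => i _; have := fintype0 i I0.
have cI : 0 < #|I|%:R :> R by rewrite ltr0n.
set S := \sum_i f i; set Q := \sum_i f i ^+ 2.
have : 0 <= \sum_i (#|I|%:R * f i - S) ^+ 2 by apply: sumr_ge0 => i _; exact: sqr_ge0.
have -> : \sum_i (#|I|%:R * f i - S) ^+ 2 = #|I|%:R * (#|I|%:R * Q - S ^+ 2).
  transitivity (\sum_i (#|I|%:R ^+ 2 * f i ^+ 2 - (2 * #|I|%:R * S) * f i + S ^+ 2)).
    by apply: eq_bigr => i _; ring.
  rewrite big_split sumrB -!mulr_sumr sumr_const -[_ *+ #|I|]mulr_natl /= -/S -/Q.
  by ring.
by rewrite pmulr_rge0// subr_ge0.
Qed.

(** * The two regret bounds on the concentration event *)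

Section RegretBounds.
Context (R : realType) (B K : nat) (H : 'I_B -> nat)
  (m : 'I_B -> 'I_K -> nat) (order : 'I_B -> seq 'I_K) (L : R)
  (mu : 'I_K -> R) (istar : 'I_K) (x : 'I_K -> nat -> R) (a : nat -> 'I_K).
Hypotheses (hm : forall b, (floor_total m b <= H b)%N)
  (horder : mandatory_order m order) (run : bdq_ucb_run H m order L x a)
  (conc : concentrated mu L (horizon H) x) (L0 : 0 <= L)
  (hstar : best_arm mu istar) (mu01 : forall i, 0 <= mu i <= 1).

(** The truncated predecessor gives 0 for an arm without residual pulls. *)
Let n i : nat := (residual_pulls H m a i).-1.
Let g i : R := gap mu istar i.

Let g0 i : 0 <= g i. Proof. by rewrite /g /gap subr_ge0. Qed.

Let n_le_residual : (\sum_(i < K) n i <= residual H m)%N.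
Proof. by rewrite -(sum_residual_pulls a hm); apply: leq_sum => i _; exact: leq_pred. Qed.

(** Squaring [g i <= 2 * sqrt (2 * L / n i)] produces the constant [4 * 2 = 8]. The product form
    covers [n i = 0] and feeds both regret bounds. *)
Let ngap i : (n i)%:R * g i ^+ 2 <= 8 * L.
Proof.
have [->|n0] := posnP (n i); first by rewrite mul0r mulr_ge0.
have n0' : 0 < (n i)%:R :> R by rewrite ltr0n.
rewrite -ler_pdivlMl//.
have := residual_pulls_gap istar run conc L0 n0; rewrite -/(g i) -/(n i).
rewrite -(@ler_pXn2r _ 2)// ?nnegrE ?mulr_ge0 ?sqrtr_ge0//.
rewrite exprMn sqr_sqrtr ?divr_ge0 ?mulr_ge0//.
by move=> /le_trans; apply; rewrite le_eqVlt; apply/orP; left; apply/eqP; field;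
  rewrite gt_eqF.
Qed.

(* One residual pull of each arm is charged [g i <= 1]; this is the term [K]. *)
Let regret_le : fair_regret H m mu istar a <= K%:R + \sum_(i < K) (n i)%:R * g i.
Proof.
rewrite (fair_regretE mu istar hm horder run).
rewrite -[X in X%:R + _](card_ord K) -sumr_const -big_split/=.
apply: ler_sum => i _; apply: (@le_trans _ _ ((n i).+1%:R * g i)).
  by rewrite ler_wpM2r// ler_nat /n leqSpred.
rewrite -natr1 mulrDl mul1r [leLHS]addrC lerD2r /g /gap.
by have := mu01 i; have := mu01 istar; lra.
Qed.

Lemma fair_regret_le_gap :
  fair_regret H m mu istar a <=
  K%:R + \sum_(i < K | 0 < gap mu istar i)
    Num.min ((residual H m)%:R * gap mu istar i) (8 * L / gap mu istar i).
Proof.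
apply: le_trans regret_le _; rewrite lerD2l [leRHS]big_mkcond.
apply: ler_sum => i _; rewrite -/(g i); case: ltP => [gi|gi]; last first.
  by rewrite (le_anti (introT andP (conj gi (g0 i)))) mulr0.
rewrite le_min; apply/andP; split.
  rewrite ler_wpM2r// ler_nat; apply: leq_trans n_le_residual.
  by rewrite (bigD1 i)//= leq_addr.
by rewrite ler_pdivlMr// -mulrA -expr2.
Qed.

Lemma fair_regret_le_sqrt :
  fair_regret H m mu istar a <=
  K%:R + 4 * Num.sqrt (2 * K%:R * (residual H m)%:R * L).
Proof.
apply: le_trans regret_le _; rewrite lerD2l.
have S0 : 0 <= \sum_(i < K) (n i)%:R * g i.
  by apply: sumr_ge0 => i _; rewrite mulr_ge0.
have s0 : 0 <= 2 * K%:R * (residual H m)%:R * L by rewrite !mulr_ge0.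
rewrite -(@ler_pXn2r _ 2)// ?nnegrE ?mulr_ge0 ?sqrtr_ge0//.
rewrite exprMn sqr_sqrtr//; apply: le_trans (sqr_sum_le _) _.
rewrite card_ord.
(* One factor [n i] is kept: [n i ^+ 2 * g i ^+ 2 <= n i * (8 * L)], and the [n i] sum to at most
   the number of residual rounds. *)
have Hn : \sum_(i < K) ((n i)%:R * g i) ^+ 2 <= (residual H m)%:R * (8 * L).
  apply: (@le_trans _ _ (\sum_(i < K) (n i)%:R * (8 * L))).
    by apply: ler_sum => i _; rewrite exprMn expr2 -mulrA ler_wpM2l.
  by rewrite -mulr_suml -natr_sum ler_wpM2r ?mulr_ge0// ler_nat.
apply: le_trans (ler_wpM2l _ Hn) _ => //.
(* In units of [K * residual * L], the squared sum is at most 8, while the squared target is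
   [16 * 2 = 32]. *)
have : 0 <= K%:R * (residual H m)%:R * L by rewrite !mulr_ge0.
lra.
Qed.

End RegretBounds.

Unset Implicit Arguments.
Set Strict Implicit.

Theorem theorem3 (R : realType) (d : measure_display)
    (Omega : measurableType d) (P : probability Omega R)
    (K B : nat) (mu : 'I_K -> R) (X : 'I_K -> nat -> {RV P >-> R})
    (istar : 'I_K) (H : 'I_B -> nat) (m : 'I_B -> 'I_K -> nat)
    (order : 'I_B -> seq 'I_K) (eta : R) (A : nat -> Omega -> 'I_K)
    (hX : stochastic_bandit mu X)
    (hstar : best_arm mu istar)
    (hm : forall b, (floor_total m b <= H b)%N)
    (horder : mandatory_order m order)
    (heta : 0 < eta < 1)
    (hAmeas : forall t i, measurable [set w | A t w = i])
    (hA : forall w, bdq_ucb_run H m order (log_factor K (horizon H) eta)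
                      (fun i n => X i n w) (fun t => A t w)) :
  let L := log_factor K (horizon H) eta in
  let Rres : R := (residual H m)%:R in
  [/\ forall w b i, (m b i <= block_pulls H (fun t => A t w) b i)%N,
      ((1 - eta)%:E <=
        P [set w | (fair_regret H m mu istar (fun t => A t w) <=
            K%:R + \sum_(i < K | 0 < gap mu istar i)
              Num.min (Rres * gap mu istar i) (8 * L / gap mu istar i))%R])%E
    & ((1 - eta)%:E <=
        P [set w | (fair_regret H m mu istar (fun t => A t w) <=
            K%:R + 4 * Num.sqrt (2 * K%:R * Rres * L))%R])%E ].
Proof.
move=> L Rres.
have K0 : (0 < K)%N := leq_ltn_trans (leq0n _) (ltn_ord istar).
have L0 : 0 <= L by exact: log_factor_ge0.
have [mG PG] := concentrated_probability istar (horizon H) hX heta.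
(* The means inherit the range of the rewards, through the clipped version of the first reward of
   each arm. *)
have mu01 i : 0 <= mu i <= 1.
  have [C [mC C01 _ EC]] := clip_01 (reward_support hX i 0) (reward_mean hX i 0).
  exact: mean_01 mC C01 EC.
split.
- move=> w b i; exact: (floor_le_block_pulls b i hm horder (hA w)).
(* Both regret bounds hold at every outcome of the same concentration event, so monotonicity of [P]
   suffices. *)
- apply: le_trans PG _; apply: le_measure; rewrite ?inE//.
    exact: measurable_fair_regret.
  move=> w Gw; exact: (fair_regret_le_gap hm horder (hA w) Gw L0 hstar mu01).
- apply: le_trans PG _; apply: le_measure; rewrite ?inE//.
    exact: measurable_fair_regret.
  move=> w Gw; exact: (fair_regret_le_sqrt hm horder (hA w) Gw L0 hstar mu01).
Qed.
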